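(* Let $(\mathcal{B},\mathcal{L},\theta,\mathcal{I}_\alpha)$ be a generalized Boolean dynamical system with associated inverse semigroup $S$, let $\mathsf{T}$ be the space of tight filters in $E(S)$, $\mathsf{T}^{(1)}=\{\xi^\alpha\in\mathsf{T}:\alpha\in\mathcal{W}^{\leq\infty},|\alpha|\ge1\}$, and let $\sigma:\mathsf{T}^{(1)}\to\mathsf{T}$ be defined by $\sigma(\xi^\alpha)=H_{[\alpha_1]\gamma}(\xi^\alpha)$ if $\alpha=\alpha_1\gamma$ with $\alpha_1\in\mathcal{L}$. Then: (i) $\mathsf{T}^{(1)}$ is open (in $\mathsf{T}$); (ii) $\sigma$ is a local homeomorphism.
   Context: **Generalized Boolean dynamical systems.** A Boolean algebra $\mathcal{B}$ is a (not necessarily unital) relatively complemented distributive lattice with least element $\emptyset$ and operations $\cap,\cup,\setminus$; $A\subseteq B$ means $A\cap B=A$. An ideal is a non-empty subset closed under finite unions and under intersection with arbitrary elements of $\mathcal{B}$. An action is a map $\mathcal{B}\to\mathcal{B}$ preserving $\cap,\cup,\setminus$ and $\emptyset$. A generalized Boolean dynamical system $(\mathcal{B},\mathcal{L},\theta,\mathcal{I}_\alpha)$ consists of a Boolean algebra $\mathcal{B}$, a set $\mathcal{L}$, actions $\{\theta_\alpha\}_{\alpha\in\mathcal{L}}$ and ideals $\{\mathcal{I}_\alpha\}_{\alpha\in\mathcal{L}}$ with $\{A\in\mathcal{B}:A\subseteq\theta_\alpha(B)\text{ for some }B\in\mathcal{B}\}\subseteq\mathcal{I}_\alpha$ for all $\alpha\in\mathcal{L}$.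 **Words.** $\mathcal{L}^*$: finite words over $\mathcal{L}$ (including the empty word $\emptyset$); $\mathcal{L}^\infty$: infinite words; $|\alpha|$: length; $\alpha_{i,j}=\alpha_i\cdots\alpha_j$ (empty if $j<i$). For $\alpha=\alpha_1\cdots\alpha_n$: $\theta_\alpha=\theta_{\alpha_n}\circ\cdots\circ\theta_{\alpha_1}$, $\theta_\emptyset=\mathrm{Id}$; $\mathcal{I}_\alpha=\{A\in\mathcal{B}:A\subseteq\theta_{\alpha_2\cdots\alpha_n}(B)\text{ for some }B\in\mathcal{I}_{\alpha_1}\}$ for $n\ge1$, $\mathcal{I}_\emptyset=\mathcal{B}$. $\mathcal{W}^*=\{\alpha\in\mathcal{L}^*:\mathcal{I}_\alpha\neq\{\emptyset\}\}$, $\mathcal{W}^\infty=\{\alpha\in\mathcal{L}^\infty:\alpha_{1,n}\in\mathcal{W}^*\ \forall n\geq1\}$, $\mathcal{W}^{\leq\infty}=\mathcal{W}^*\cup\mathcal{W}^\infty$. **Inverse semigroup.** $S=\{(\alpha,A,\beta):\alpha,\beta\in\mathcal{L}^*,\ \emptyset\neq A\in\mathcal{I}_\alpha\cap\mathcal{I}_\beta\}\cup\{0\}$, with $0$ absorbing and $(\alpha,A,\beta)(\gamma,B,\delta)$ equal to $(\alpha,A\cap B,\delta)$ if $\beta=\gamma$; $(\alpha\gamma',\theta_{\gamma'}(A)\cap B,\delta)$ if $\gamma=\beta\gamma'$; $(\alpha,A\cap\theta_{\beta'}(B),\delta\beta')$ if $\beta=\gamma\beta'$ (interpreted as $0$ when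 the middle entry is $\emptyset$); $0$ otherwise. Its semilattice of idempotents is $E(S)=\{(\alpha,A,\alpha):\emptyset\neq A\in\mathcal{I}_\alpha\}\cup\{0\}$, ordered by $e\le f$ iff $ef=e$. **Tight filters.** A filter in a poset with least element is a non-empty, upward closed, downward directed subset not containing the least element. Each filter $\xi$ in $E(S)$ has an associated word $\alpha\in\mathcal{W}^{\leq\infty}$ (the longest first entry of elements of $\xi$, or, if lengths are unbounded, the infinite word of which all first entries are beginnings); write $\xi=\xi^\alpha$ and $\xi_n=\{A\in\mathcal{I}_{\alpha_{1,n}}:(\alpha_{1,n},A,\alpha_{1,n})\in\xi\}$, $0\le n\le|\alpha|$, $n<\infty$; $\xi$ is determined by $\alpha$ and $\{\xi_n\}_n$. A finite $Z\subseteq\{y:y\le x\}$ is a cover for $x\in E(S)$ if every $0\neq y\le x$ satisfies $yz\neq0$ for some $z\in Z$; $\xi$ is tight if $Z\cap\xi\neq\emptyset$ for each $x\in\xi$ and each finite cover $Z$ of $x$. $\mathsf{T}$ is the set of tight filters, topologized by pointwise convergence of characteristic functions; a basis is given by $V_{e:e_1,\dots,e_n}=\{\xi\in\mathsf{T}:e\in\xi,e_i\notin\xi\ \forall i\}$, $e,e_i\in E(S)$, $n\ge0$. **Cutting map.** For $\alpha_1\in\mathcal{L}$ and $\alpha_1\gamma\in\mathcal{W}^{\le\infty}$, $H_{[\alpha_1]\gamma}$ sends a tight filter $\xi$ with word $\alpha_1\gamma$ to the (tight) filter $\eta$ with word $\gamma$ and $\eta_n=\{B\in\mathcal{I}_{\gamma_{1,n}}:A\subseteq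 B\text{ for some }A\in\xi_{n+1}\}$, $0\le n\le|\gamma|$. *)

(* Defs.v *)
From HB Require Import structures.
From mathcomp Require Import all_boot all_order.
From mathcomp Require Import all_classical topology.
From mathcomp Require Import zify.

Set Implicit Arguments.
Unset Strict Implicit.
Unset Printing Implicit Defensive.

Import Order.TTheory.
Local Open Scope classical_set_scope.
Local Open Scope order_scope.

(* As U and f @` U are open, the within-continuity of f and of its inverse g says
   that f restricts to a homeomorphism from U onto f @` U. *)
Definition local_homeomorphism (X Y : topologicalType) (f : X -> Y) : Prop :=
  forall x, exists U : set X,
    [/\ open U, U x, open (f @` U), {within U, continuous f} &
        exists g : Y -> X, (forall u, U u -> g (f u) = u) /\
                           {within f @` U, continuous g}].

(* The poset is the subset E of X, with le only relevant on E and least element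
   bot. *)
Definition is_filter (X : Type) (E : set X) (le : X -> X -> Prop) (bot : X)
    (F : set X) : Prop :=
  [/\ F `<=` E,
      F !=set0,
      ~ F bot,
      forall x y, F x -> E y -> le x y -> F y &
      forall x y, F x -> F y -> exists z, [/\ F z, le z x & le z y]].

(* Boolean algebras, i.e. relatively complemented distributive lattices with a
   least element and no required top, are MathComp's cbDistrLatticeType. *)
Definition is_action (d : Order.disp_t) (B : cbDistrLatticeType d)
    (f : B -> B) : Prop :=
  [/\ {morph f : x y / x `&` y}, {morph f : x y / x `|` y},
      {morph f : x y / x `\` y} & f \bot = \bot].

Definition is_ideal (d : Order.disp_t) (B : cbDistrLatticeType d)
    (J : set B) : Prop :=
  [/\ J !=set0, forall x y, J x -> J y -> J (x `|` y) &
      forall x y, J x -> J (x `&` y)].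

Record gbds (d : Order.disp_t) (B : cbDistrLatticeType d) (L : eqType) := Gbds {
  act : L -> B -> B;
  ideal : L -> set B;
  act_action : forall a, is_action (act a);
  ideal_ideal : forall a, is_ideal (ideal a);
  act_ideal : forall a (x y : B), x <= act a y -> ideal a x }.

Inductive gword (L : Type) := Fin of seq L | Inf of (nat -> L).

(* n <= |al|, for n finite. *)
Definition gle (L : Type) (n : nat) (al : gword L) : Prop :=
  match al with Fin w => (n <= size w)%N | Inf _ => True end.

(* al_{1,n}, meaningful for gle n al. *)
Definition gtake (L : Type) (n : nat) (al : gword L) : seq L :=
  match al with Fin w => take n w | Inf f => mkseq f n end.

Definition gcons (L : Type) (a : L) (ga : gword L) : gword L :=
  match ga with
  | Fin w => Fin (a :: w)
  | Inf f => Inf (fun n => if n is m.+1 then f m else a)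
  end.

Section Gbds.
Context (d : Order.disp_t) (B : cbDistrLatticeType d) (L : eqType).

(* Raw carrier of the inverse semigroup; None stands for 0. *)
Definition triple := option (seq L * B * seq L).

Definition tri (al : seq L) (x : B) (be : seq L) : triple :=
  if x == \bot then None else Some (al, x, be).

Definition idm (al : seq L) (x : B) : triple := Some (al, x, al).

Variable D : gbds B L.

Definition actw (w : seq L) (x : B) : B := foldl (fun y a => act D a y) x w.

Definition idealw (w : seq L) : set B :=
  if w is a :: w' then [set x | exists2 y, ideal D a y & x <= actw w' y]
  else setT.

Definition Wstar : set (seq L) := [set w | idealw w <> [set \bot]].

Definition Winf : set (nat -> L) :=
  [set f | forall n, (1 <= n)%N -> Wstar (mkseq f n)].

Definition Wleinf : set (gword L) :=
  [set al | match al with Fin w => Wstar w | Inf f => Winf f end].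

Definition inS : set triple :=
  [set s | if s is Some (al, x, be) then
             [/\ x <> \bot, idealw al x & idealw be x]
           else True].

Definition mulS (s t : triple) : triple :=
  match s, t with
  | Some (al, x, be), Some (ga, y, de) =>
      if be == ga then tri al (x `&` y) de
      else if prefix be ga then
        let ga' := drop (size be) ga in tri (al ++ ga') (actw ga' x `&` y) de
      else if prefix ga be then
        let be' := drop (size ga) be in tri al (x `&` actw be' y) (de ++ be')
      else None
  | _, _ => None
  end.

Definition ES : set triple :=
  [set e | e = None \/
     exists al x, [/\ x <> \bot, idealw al x & e = idm al x]].

Definition leS (e f : triple) : Prop := mulS e f = e.

Definition filterE (xi : set triple) : Prop := is_filter ES leS None xi.

Definition is_cover (x : triple) (Z : set triple) : Prop :=
  [/\ finite_set Z, forall z, Z z -> ES z /\ leS z x &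
      forall y, ES y -> y <> None -> leS y x ->
        exists2 z, Z z & mulS y z <> None].

Definition is_tight (xi : set triple) : Prop :=
  filterE xi /\
  forall x Z, xi x -> is_cover x Z -> exists2 z, Z z & xi z.

Definition is_assoc_word (xi : set triple) (al : gword L) : Prop :=
  match al with
  | Fin w => (exists x, xi (idm w x)) /\
             forall v x, xi (idm v x) -> (size v <= size w)%N
  | Inf f => (forall v x, xi (idm v x) -> v = mkseq f (size v)) /\
             forall n, exists v x, xi (idm v x) /\ (n <= size v)%N
  end.

(* xi_n, for xi a filter with associated word al and gle n al; xi_0 may be
   empty even if al is not the empty word. *)
Definition fam (al : gword L) (xi : set triple) (n : nat) : set B :=
  [set x | idealw (gtake n al) x /\ xi (idm (gtake n al) x)].

Definition cut_fam (a : L) (ga : gword L) (xi : set triple) (n : nat) : set B :=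
  [set y | idealw (gtake n ga) y /\
           exists2 x, fam (gcons a ga) xi n.+1 x & x <= y].

Definition cut (a : L) (ga : gword L) (xi : set triple) : set triple :=
  [set e | exists n y,
     [/\ gle n ga, cut_fam a ga xi n y & e = idm (gtake n ga) y]].

Lemma actw_cat u v x : actw (u ++ v) x = actw v (actw u x).
Proof. by rewrite /actw foldl_cat. Qed.

Lemma actwI w : {morph actw w : x y / x `&` y}.
Proof.
elim: w => [//|a w IH] x y /=.
by case: (act_action D a) => h _ _ _; rewrite h IH.
Qed.

Lemma actw0 w : actw w \bot = \bot.
Proof. by elim: w => [//|a w IH] /=; case: (act_action D a) => _ _ _ ->. Qed.

Lemma actw_le w x y : x <= y -> actw w x <= actw w y.
Proof. by rewrite !leEmeet => /eqP h; rewrite -actwI h. Qed.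

Lemma ideal_down a x y : y <= x -> ideal D a x -> ideal D a y.
Proof.
rewrite leEmeet meetC => /eqP h; case: (ideal_ideal D a) => _ _ hI hx.
by rewrite -h; apply: hI.
Qed.

Lemma idealw_down w x y : y <= x -> idealw w x -> idealw w y.
Proof.
case: w => [//|a w] yx [z hz xz]; exists z => //; exact: le_trans xz.
Qed.

Lemma idealw_actw w x : idealw w (actw w x).
Proof.
case: w => [//|a w]; exists (act D a x) => //.
exact: (@act_ideal _ _ _ D a _ x).
Qed.

Lemma idealw_catl u v x : idealw u x -> idealw (u ++ v) (actw v x).
Proof.
case: u => [_|a u [y hy xy]]; first exact: idealw_actw.
by exists y => //; rewrite actw_cat actw_le.
Qed.

Lemma idealw_catr u v x : idealw (u ++ v) x -> idealw v x.
Proof.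
case: u => [//|a u] [y hy]; rewrite actw_cat => h.
exact/(idealw_down h)/idealw_actw.
Qed.

Lemma idealw_prefix a u v x : idealw (a :: u ++ v) x ->
  exists2 y, idealw (a :: u) y & x <= actw v y.
Proof. by case=> y hy; rewrite actw_cat => h; exists (actw u y)=> //; exists y. Qed.

Lemma tri_id al x be : x <> \bot -> tri al x be = Some (al, x, be).
Proof. by rewrite /tri => /eqP/negbTE ->. Qed.

Lemma tri_bot al be : tri al \bot be = None.
Proof. by rewrite /tri eqxx. Qed.

Lemma tri_neq0 al x be : tri al x be <> None -> x <> \bot.
Proof. by move=> h xE; apply: h; rewrite xE tri_bot. Qed.

Lemma mulS_catr al x be w y de :
  mulS (Some (al, x, be)) (Some (be ++ w, y, de)) =
  tri (al ++ w) (actw w x `&` y) de.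
Proof.
rewrite /= prefix_prefix drop_size_cat //; case: eqP => // h.
have /nilP -> /= : nilp w by move/(congr1 size): h; rewrite size_cat /nilp; lia.
by rewrite cats0.
Qed.

Lemma mulS_catl al x ga w y de :
  mulS (Some (al, x, ga ++ w)) (Some (ga, y, de)) =
  tri al (x `&` actw w y) (de ++ w).
Proof.
rewrite /= prefix_prefix drop_size_cat //.
case: eqP => [h|hN]; last case: ifP => [/prefixP [w' h]|//].
  have /nilP -> /= : nilp w by move/(congr1 size): h; rewrite size_cat /nilp; lia.
  by rewrite cats0.
case: hN; rewrite [LHS](_ : _ = ga ++ [::]) ?cats0 //.
have /nilP -> : nilp w; last by rewrite cats0.
by move/(congr1 size): h; rewrite !size_cat /nilp; lia.
Qed.

Lemma mulS_closed s t : inS s -> inS t -> inS (mulS s t).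
Proof.
have tri_in al x be : idealw al x -> idealw be x -> inS (tri al x be).
  by move=> h1 h2; rewrite /tri; case: eqP.
case: s t => [[[al x] be]|] [[[ga y] de]|] //= [_ h1 h2] [_ h3 h4].
case: eqP => [_|_].
  by apply: tri_in; [apply: idealw_down h1; rewrite leIl|
                     apply: idealw_down h4; rewrite leIr].
case: ifP => [_|_]; last case: ifP => [_|//].
  apply: tri_in; last by apply: idealw_down h4; rewrite leIr.
  by apply: idealw_down (idealw_catl _ h1); rewrite leIl.
apply: tri_in; first by apply: idealw_down h1; rewrite leIl.
by apply: idealw_down (idealw_catl _ h4); rewrite leIr.
Qed.

Lemma ES_idempotents : ES = [set s | inS s /\ mulS s s = s].
Proof.
apply/seteqP; split=> [e [->|[al [x [x0 hx ->]]]]|[[[al x] be]|]].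
- by [].
- by split=> //; rewrite /idm /= eqxx meetxx tri_id.
- case=> -[x0 h1 h2]; rewrite /mulS; case: eqP => [-> _|hN].
    by right; exists al, x.
  have nilE (w v : seq L) : size (v ++ w) = size v -> w = [::].
    by rewrite size_cat => h; apply/size0nil; lia.
  case: ifP => [/prefixP[w ww]|_]; last case: ifP => [/prefixP[w ww]|//].
    rewrite /tri; case: eqP => // _ [/(congr1 size) + _].
    by rewrite ww drop_size_cat // => /nilE w0; case: hN; rewrite ww w0 cats0.
  rewrite /tri; case: eqP => // _ [_ /(congr1 size)].
  by rewrite ww drop_size_cat // => /nilE w0; case: hN; rewrite ww w0 cats0.
- by move=> _; left.
Qed.

Lemma idm_inj u v x y : idm u x = idm v y -> u = v /\ x = y.
Proof. by case. Qed.

Lemma ES_idm u x : ES (idm u x) <-> x <> \bot /\ idealw u x.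
Proof.
split=> [[] // [v [y [y0 hy /idm_inj [-> ->]]]] //|[x0 hx]].
by right; exists u, x.
Qed.

Lemma mul_idm_catr u w x y :
  mulS (idm u x) (idm (u ++ w) y) = tri (u ++ w) (actw w x `&` y) (u ++ w).
Proof. exact: mulS_catr. Qed.

Lemma mul_idm_catl u w x y :
  mulS (idm (u ++ w) x) (idm u y) = tri (u ++ w) (x `&` actw w y) (u ++ w).
Proof. exact: mulS_catl. Qed.

Lemma mul_idm_neq0 u v x y : mulS (idm u x) (idm v y) <> None ->
  (exists2 w, v = u ++ w & actw w x `&` y <> \bot) \/
  (exists2 w, u = v ++ w & x `&` actw w y <> \bot).
Proof.
rewrite /idm /=; case: eqP => [->|_].
  by move=> /tri_neq0 h; left; exists [::]; rewrite ?cats0.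
case: ifP => [/prefixP[w ->]|_]; last case: ifP => [/prefixP[w ->]|//].
  by rewrite drop_size_cat // => /tri_neq0 h; left; exists w.
by rewrite drop_size_cat // => /tri_neq0 h; right; exists w.
Qed.

Lemma leS_idm u v x y : x <> \bot ->
  leS (idm u x) (idm v y) <-> exists2 w, u = v ++ w & x <= actw w y.
Proof.
move=> x0; rewrite /leS; split=> [h|[w -> xy]].
  have : mulS (idm u x) (idm v y) <> None by rewrite h.
  case/mul_idm_neq0 => [[w vE _]|[w uE _]].
    move: h; rewrite vE mul_idm_catr /tri; case: eqP => // _ [+ hx _].
    move=> /(congr1 size); rewrite size_cat => h.
    have /nilP w0 : nilp w by rewrite /nilp; lia.
    exists [::]; first by rewrite w0 !cats0.
    by move: hx; rewrite w0 /= => /eqP; rewrite -leEmeet.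
  exists w => //; move: h; rewrite uE mul_idm_catl /tri; case: eqP => // _ [+].
  by move/eqP; rewrite -leEmeet.
move: (xy); rewrite leEmeet mul_idm_catl => /eqP ->; exact: tri_id.
Qed.

Lemma leS0 e : leS None e. Proof. by []. Qed.

Lemma filter_elt xi e : filterE xi -> xi e ->
  exists v x, [/\ x <> \bot, idealw v x & e = idm v x].
Proof.
case=> hE _ h0 _ _ he; case: (hE _ he) => [e0|//].
by case: h0; rewrite -e0.
Qed.

Lemma filter_idm xi v x : filterE xi -> xi (idm v x) ->
  x <> \bot /\ idealw v x.
Proof. by case=> hE _ _ _ _ /hE /ES_idm. Qed.

Lemma filter_dir xi u v x y : filterE xi -> xi (idm u x) -> xi (idm v y) ->
  exists w w' z, [/\ xi (idm (u ++ w) z), u ++ w = v ++ w',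
                     z <= actw w x & z <= actw w' y].
Proof.
move=> hf hx hy; have [hE _ _ _ hD] := hf.
have [e [he ex ey]] := hD _ _ hx hy.
have [t [z [z0 _ eE]]] := filter_elt hf he; move: he ex ey; rewrite eE => hz.
move=> /(leS_idm _ _ _ z0)[w tE xz] /(leS_idm _ _ _ z0)[w' tE' yz].
by exists w, w', z; rewrite -tE -tE'; split.
Qed.

Lemma filter_up xi u w x y : filterE xi -> xi (idm (u ++ w) x) ->
  idealw u y -> x <= actw w y -> xi (idm u y).
Proof.
move=> hf hx hy xy; have [x0 _] := filter_idm hf hx.
have y0 : y <> \bot by move=> yE; apply: x0; apply/eqP;
  move: xy; rewrite yE actw0 lex0.
have [_ _ _ hU _] := hf; apply: hU hx _ _; first exact/ES_idm.
by apply/leS_idm => //; exists w.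
Qed.

Lemma filter_take xi a u w x : filterE xi -> xi (idm (a :: u ++ w) x) ->
  exists y, xi (idm (a :: u) y).
Proof.
move=> hf hx; have [x0 hi] := filter_idm hf hx.
have [y hy xy] := idealw_prefix hi.
by exists y; apply: (@filter_up _ (a :: u) w _ _ hf hx hy xy).
Qed.

Lemma assoc_word_ex xi : filterE xi -> exists al, is_assoc_word xi al.
Proof.
move=> hf; have [_ [e0 he0] _ _ _] := hf.
have [v0 [x0 [_ _ e0E]]] := filter_elt hf he0; rewrite {}e0E in he0.
have [[N hN]|hN] :=
    pselect (exists N, forall v x, xi (idm v x) -> (size v <= N)%N).
  pose P n := `[< exists v x, xi (idm v x) /\ size v = n >].
  have exP : exists n, P n by exists (size v0); apply/asboolP; exists v0, x0.
  have leP n : P n -> (n <= N)%N by move=> /asboolP[v [x [/hN + <-]]].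
  case: (ex_maxnP exP leP) => n /asboolP[v [x [hx vn]]] hmax.
  exists (Fin v); split=> [|u y hy]; first by exists x.
  by rewrite vn; apply: hmax; apply/asboolP; exists u, y.
have unb n : exists v, (exists x, xi (idm v x)) /\ (n < size v)%N.
  apply: contrapT => hn; apply: hN; exists n => v x hx; rewrite leqNgt.
  by apply/negP => nv; apply: hn; exists v; split=> //; exists x.
have [g hg] := choice unb.
have [a _] : exists a : L, True by case: (g 0) (hg 0) => [[]|a ? _] //; exists a.
exists (Inf (fun n => nth a (g n) n)); split=> [v x hx|n]; last first.
  by have [[x hx] /ltnW hn] := hg n; exists (g n), x.
apply: (@eq_from_nth _ a); rewrite ?size_mkseq // => i iv.
rewrite nth_mkseq //; have [[y hy] ig] := hg i.
have [w [w' [z [_ uE _ _]]]] := filter_dir hf hx hy.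
by have := congr1 (nth a ^~ i) uE; rewrite /= !nth_cat iv ig.
Qed.

Lemma assoc_word_prefix xi al v x : filterE xi -> is_assoc_word xi al ->
  xi (idm v x) -> gle (size v) al /\ v = gtake (size v) al.
Proof.
move=> hf; case: al => [w|f] [].
  move=> [y hy] hmax hx; split; first exact: hmax hx.
  have [s [s' [z [hz vE _ _]]]] := filter_dir hf hx hy.
  have := hmax _ _ hz; rewrite vE size_cat => hs.
  have /nilP s'0 : nilp s' by rewrite /nilp; lia.
  by move: vE; rewrite s'0 cats0 /= => <-; rewrite take_size_cat.
by move=> hw _ hx; split=> //; apply: hw hx.
Qed.

Lemma assoc_word_unique xi al be : filterE xi ->
  is_assoc_word xi al -> is_assoc_word xi be -> al = be.
Proof.
move=> hf.
case: al be => [w|f] [v|g] h1 h2.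
- have [[x hx] m1] := h1; have [[y hy] m2] := h2.
  have [_] := assoc_word_prefix hf h2 hx.
  by rewrite /= take_oversize ?(m1 _ _ hy) // => ->.
- have [_ m1] := h1; have [_ /(_ (size w).+1) [v [x [/m1 h /(leq_trans) ]]]] := h2.
  by move=> /(_ _ h); rewrite ltnn.
- have [_ m1] := h2; have [_ /(_ (size v).+1) [u [x [/m1 h /(leq_trans) ]]]] := h1.
  by move=> /(_ _ h); rewrite ltnn.
- congr Inf; apply/funext => n; have [_ /(_ n.+1) [u [x [hx hn]]]] := h1.
  have [_ e1] := assoc_word_prefix hf h1 hx.
  have [_ e2] := assoc_word_prefix hf h2 hx.
  have := congr1 (nth (f n) ^~ n) (etrans (esym e1) e2).
  by rewrite /= !nth_mkseq.
Qed.

Lemma gle_cons (a : L) (ga : gword L) n : gle n.+1 (gcons a ga) <-> gle n ga.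
Proof. by case: ga. Qed.

Lemma gtake_cons (a : L) (ga : gword L) n : gtake n.+1 (gcons a ga) = a :: gtake n ga.
Proof.
case: ga => [w|f] //=; rewrite /mkseq /= -[1%N]addn0 iotaDl -map_comp.
by congr cons; apply: eq_map.
Qed.

Lemma size_gtake n (al : gword L) : gle n al -> size (gtake n al) = n.
Proof. by case: al => [w|f] /= h; [rewrite size_takel | rewrite size_mkseq]. Qed.

Lemma take_gtake n m (al : gword L) : (n <= m)%N ->
  take n (gtake m al) = gtake n al.
Proof.
move=> nm; case: al => [w|f] /=; first exact: take_takel.
by rewrite /mkseq -map_take take_iota (minn_idPl nm).
Qed.

Section Cut.
Variables (a : L) (ga : gword L) (xi : set triple).
Hypothesis hf : filterE xi.
Hypothesis hw : is_assoc_word xi (gcons a ga).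

Lemma assoc_word_cons b v x : xi (idm (b :: v) x) ->
  [/\ b = a, gle (size v) ga & v = gtake (size v) ga].
Proof.
move=> hx; have [/= /gle_cons h] := assoc_word_prefix hf hw hx.
by rewrite gtake_cons => -[].
Qed.

Lemma cutP v y : cut a ga xi (idm v y) <->
  idealw v y /\ exists2 x, xi (idm (a :: v) x) & x <= y.
Proof.
split=> [[n [z [hn [hz [x [hx hx'] xz]] /idm_inj[-> ->]]]]|[hv [x hx xy]]].
  by split=> //; exists x => //; rewrite -gtake_cons.
have [_ h1 h2] := assoc_word_cons hx.
exists (size v), y; rewrite -h2; split=> //; split; first by rewrite -h2.
exists x => //; rewrite /fam /= gtake_cons -h2; split=> //.
by have [] := filter_idm hf hx.
Qed.

Lemma cut_elt e : cut a ga xi e -> exists v y, e = idm v y.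
Proof. by move=> [n [y [_ _ ->]]]; exists (gtake n ga), y. Qed.

Lemma cut_ES : cut a ga xi `<=` ES.
Proof.
move=> e he; have [v [y eE]] := cut_elt he; move: he; rewrite eE.
move=> /cutP[hv [x /(filter_idm hf)[x0 _] xy]]; apply/ES_idm; split=> //.
by move=> yE; apply: x0; apply/eqP; rewrite -lex0 -yE.
Qed.

Lemma assoc_word_long n : gle n ga ->
  exists v x, xi (idm (a :: v) x) /\ (n <= size v)%N.
Proof.
case: ga hw => [w|f] /= [].
  by move=> [x hx] _ hn; exists w, x.
move=> h /(_ n.+1) [v [x [hx hv]]] _.
case: v hx hv (h _ _ hx) => [|b v] hx hv; first by [].
by case=> bE _; exists v, x; rewrite -{1}bE.
Qed.

Lemma cut_fam_neq0 n : gle n ga -> exists y, xi (idm (a :: gtake n ga) y).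
Proof.
move=> hn; have [v [x [hx nv]]] := assoc_word_long hn.
have [_ hv vE] := assoc_word_cons hx.
suff h : v = gtake n ga ++ drop n v.
  by move: hx; rewrite {1}h; apply: filter_take.
by rewrite -(take_gtake _ nv) -vE cat_take_drop.
Qed.

Lemma cut_filter : filterE (cut a ga xi).
Proof.
split.
- exact: cut_ES.
- have h0 : gle 0 ga by case: (ga).
  have [y hy] := cut_fam_neq0 h0; exists (idm (gtake 0 ga) y); apply/cutP.
  split; last by exists y.
  have [_] := filter_idm hf hy; exact: (@idealw_catr [:: a]).
- by move=> /cut_elt[v [y]].
- move=> e f he hfE hle; have [v [y eE]] := cut_elt he.
  have [y0 _] : y <> \bot /\ idealw v y by apply/ES_idm; rewrite -eE; exact: cut_ES.
  move: hfE hle; rewrite eE => -[-> //|[u [z [z0 hz ->]]]].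
  move=> /(leS_idm _ _ _ y0)[w vE yz]; move: he; rewrite eE vE.
  move=> /cutP[_ [x hx xy]]; apply/cutP; split=> //.
  have [x0 hx'] := filter_idm hf hx.
  have [c hc xc] := idealw_prefix hx'.
  exists (c `&` z); last by rewrite leIr.
  apply: (@filter_up _ (a :: u) w _ _ hf hx).
    by apply: idealw_down hc; rewrite leIl.
  by rewrite actwI lexI xc (le_trans xy).
- move=> e f he hfE; have [v [y eE]] := cut_elt he.
  have [v' [y' fE]] := cut_elt hfE; move: he hfE; rewrite eE fE.
  move=> /cutP[_ [x hx xy]] /cutP[_ [x' hx' xy']].
  have [w [w' [z [hz uE h1 h2]]]] := filter_dir hf hx hx'.
  have [z0 hzi] := filter_idm hf hz.
  move: uE => -[uE]; exists (idm (v ++ w) z); split.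
  + by apply/cutP; split; [exact: (@idealw_catr [:: a]) | exists z].
  + by apply/leS_idm => //; exists w => //; apply/(le_trans h1)/actw_le.
  + by apply/leS_idm => //; exists w' => //; apply/(le_trans h2)/actw_le.
Qed.

Lemma cut_assoc_word : is_assoc_word (cut a ga xi) ga.
Proof.
case: ga hw cutP assoc_word_cons cut_fam_neq0 => [w|f] hw' hcut hcons hne.
  split=> [|v y /hcut[_ [x /hcons[_ //]]]].
  have [|y hy] := hne (size w); first exact: leqnn.
  exists y; apply/hcut; move: hy; rewrite /= take_size => hy; split; last by exists y.
  by have [_] := filter_idm hf hy; exact: (@idealw_catr [:: a]).
split=> [v y /hcut[_ [x /hcons[_ //]]]|n].
have [//|y hy] := hne n.
exists (mkseq f n), y; rewrite size_mkseq; split=> //; apply/hcut; split.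
  by have [_] := filter_idm hf hy; exact: (@idealw_catr [:: a]).
by exists y.
Qed.

Lemma cut_famE n : gle n ga -> fam ga (cut a ga xi) n = cut_fam a ga xi n.
Proof.
move=> hn; apply/seteqP; split=> y [hy].
  move=> /cutP[_ [x hx xy]]; split=> //; exists x => //.
  by split; rewrite gtake_cons //; have [] := filter_idm hf hx.
by move=> h; split=> //; exists n, y.
Qed.

End Cut.

Lemma cut_tight a ga xi : is_tight xi -> is_assoc_word xi (gcons a ga) ->
  is_tight (cut a ga xi).
Proof.
move=> [hf ht] hw; have cutE := cutP hf hw; split; first exact: cut_filter.
move=> e Z he [Zfin ZE Zcov]; have [v [y eE]] := cut_elt he.
move: he ZE Zcov; rewrite {}eE => he ZE Zcov.
have /ES_idm[y0 yi] := cut_ES hf hw he.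
have [_ [x hx xy]] := (cutE _ _).1 he.
have [x0 xi_] := filter_idm hf hx.
pose lift (t : triple) : triple := if t is Some (u, c, _) then
  tri (a :: u) (c `&` actw (drop (size v) u) x) (a :: u) else None.
have liftE w c : lift (idm (v ++ w) c) =
    tri (a :: v ++ w) (c `&` actw w x) (a :: v ++ w).
  by rewrite /lift /= drop_size_cat.
have Zform z : Z z -> z = None \/ exists w c,
    [/\ z = idm (v ++ w) c, c <> \bot, idealw (v ++ w) c & c <= actw w y].
  move=> /ZE[[->|[u [c [c0 hc ->]]]]]; first by left.
  move=> /(leS_idm _ _ _ c0)[w uE cy]; right; exists w, c; by rewrite -uE.
have tri_ES w c : c `&` actw w x <> \bot ->
    ES (idm (a :: v ++ w) (c `&` actw w x)).
  move=> h; apply/ES_idm; split=> //.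
  apply: (@idealw_down _ (actw w x)); first by rewrite leIr.
  exact: (@idealw_catl (a :: v)).
have hcov : is_cover (idm (a :: v) x) (lift @` Z).
  split; first exact: finite_image.
    move=> _ [z /Zform[->|[w [c [-> _ _ _]]]] <-]; first by split; [left|].
    rewrite liftE; have [->|/eqP h] := eqVneq (c `&` actw w x) \bot.
      by rewrite tri_bot; split; [left|].
    rewrite tri_id //; split; first exact: tri_ES.
    by apply/leS_idm => //; exists w => //; rewrite leIr.
  move=> _ [-> //|[u [b [b0 hb ->]]]] _ /(leS_idm _ _ _ b0)[m uE bx].
  rewrite uE in hb *.
  have [||| z hz hyz] := Zcov (idm (v ++ m) b).
  - by apply/ES_idm; split=> //; exact: (@idealw_catr [:: a]).
  - by [].
  - apply/leS_idm => //; exists m => //; exact/(le_trans bx)/actw_le.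
  have [zE|[w [c [zE c0 hc cy]]]] := Zform _ hz; first by rewrite zE in hyz.
  exists (lift z); first by exists z.
  move: hyz; rewrite zE liftE => /mul_idm_neq0[] [k kE hk].
    have wE : w = m ++ k.
      by move: kE; rewrite -catA => /eqP; rewrite eqseq_cat // eqxx => /eqP.
    have le1 : actw k b <= actw w x by rewrite wE actw_cat actw_le.
    have h : actw k b `&` (c `&` actw w x) = actw k b `&` c.
      by rewrite meetA meetAC (meet_idPl le1).
    have h' : c `&` actw w x <> \bot by move=> cE; apply: hk; rewrite -h cE meetx0.
    rewrite (tri_id _ _ h') [X in mulS _ (Some (X, _, X))]
      (_ : _ = (a :: v ++ m) ++ k); last by rewrite wE /= catA.
    by rewrite mul_idm_catr h tri_id.
  have mE : m = w ++ k.
    by move: kE; rewrite -catA => /eqP; rewrite eqseq_cat // eqxx => /eqP.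
  have h : b `&` actw k (c `&` actw w x) = b `&` actw k c.
    by rewrite actwI -actw_cat -mE meetA meetAC (meet_idPl bx).
  have h' : c `&` actw w x <> \bot.
    by move=> cE; apply: hk; rewrite -h cE actw0 meetx0.
  rewrite (tri_id _ _ h') [X in mulS (idm X _)]
    (_ : _ = (a :: v ++ w) ++ k); last by rewrite mE /= catA.
  by rewrite mul_idm_catl h tri_id.
have [_ [z hz <-] hxz] := ht _ _ hx hcov.
have [zE|[w [c [zE c0 hc cy]]]] := Zform _ hz.
  by case: hf => _ _ + _ _; case; move: hxz; rewrite zE.
exists z => //; rewrite zE; apply/cutE; split=> //.
move: hxz; rewrite zE liftE /tri; case: eqP => [_ h0|h hxz].
  by case: hf => _ _ /(_ h0).
by exists (c `&` actw w x) => //; rewrite leIl.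
Qed.

Definition tight_filter : Type := {xi : set triple | is_tight xi}.

HB.instance Definition _ := gen_eqMixin tight_filter.
HB.instance Definition _ := gen_choiceMixin tight_filter.

Definition char_filter (xi : tight_filter) : {ptws set_type ES -> bool} :=
  fun e => `[< sval xi (set_val e) >].

HB.instance Definition _ :=
  Topological.copy tight_filter (initial_topology char_filter).

Definition word (xi : tight_filter) : gword L :=
  projT1 (cid (assoc_word_ex (proj1 (svalP xi)))).

Lemma wordP (xi : tight_filter) : is_assoc_word (sval xi) (word xi).
Proof. exact: (projT2 (cid (assoc_word_ex (proj1 (svalP xi))))). Qed.

Lemma word_eq (xi : tight_filter) al :
  is_assoc_word (sval xi) al <-> word xi = al.
Proof.
split=> [h|<-]; last exact: wordP.
exact: assoc_word_unique (proj1 (svalP xi)) (wordP xi) h.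
Qed.

Definition cut_map (a : L) (ga : gword L) (xi : tight_filter)
    (h : word xi = gcons a ga) : tight_filter :=
  exist _ (cut a ga (sval xi)) (cut_tight (svalP xi) ((word_eq xi _).2 h)).

Lemma word_cut_map a ga xi (h : word xi = gcons a ga) : word (cut_map h) = ga.
Proof.
apply/word_eq; apply: cut_assoc_word ((word_eq xi _).2 h).
exact: proj1 (svalP xi).
Qed.

Lemma fam_cut_map a ga xi (h : word xi = gcons a ga) n : gle n ga ->
  fam ga (sval (cut_map h)) n = cut_fam a ga (sval xi) n.
Proof.
move=> hn; exact: (cut_famE (proj1 (svalP xi)) ((word_eq xi _).2 h) hn).
Qed.

Definition T1 : set tight_filter :=
  [set xi | Wleinf (word xi) /\ gle 1 (word xi)].

Lemma word_T1 (xi : T1) :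
  exists p : L * gword L, word (set_val xi) = gcons p.1 p.2.
Proof.
have [_] := set_valP xi; case: (word _) => [[//|a w]|f] _.
  by exists (a, Fin w).
exists (f 0, Inf (fun n => f n.+1)); congr Inf.
by apply/funext; case.
Qed.

Definition sigma (xi : T1) : tight_filter := cut_map (projT2 (cid (word_T1 xi))).

Lemma gcons_inj (a b : L) (ga de : gword L) :
  gcons a ga = gcons b de -> a = b /\ ga = de.
Proof.
case: ga de => [w|f] [v|g] //= [].
  by move=> -> ->.
move=> h; split; first by have := congr1 (@^~ 0) h.
by congr Inf; apply/funext => n; have := congr1 (@^~ n.+1) h.
Qed.

Lemma sigmaE (xi : T1) a ga (h : word (set_val xi) = gcons a ga) :
  sigma xi = cut_map h.
Proof.
apply: eq_exist; case: (cid _) => -[b de] /= h'.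
by have [-> ->] := gcons_inj (etrans (esym h') h).
Qed.

End Gbds.

Arguments T1 {d B L} D _.
Arguments sigma {d B L} D xi.

(* Main.v *)
Require Import Defs.
From mathcomp Require Import all_boot all_order.
From mathcomp Require Import all_classical topology.

(* Let xi be a tight filter whose word begins with a, and choose x with
   ([a], x, [a]) in xi.  On the open set U of filters containing ([a], x, [a]),
   sigma is injective with image V, the open set of tight filters containing
   ([::], x, [::]): the inverse sends eta to its preimage under the homomorphism
   unshift a of E(S), which maps (av, z, av) to (v, z, v) and ([::], z, [::]) to
   ([::], act a z, [::]).  Tightness passes to the preimage because unshift a
   maps covers to covers.  Both maps are continuous because membership of an
   element of E(S) in the image is membership of one fixed element in the
   argument: (v, y, v) is in sigma xi iff (av, y /\ act_v x, av) is in xi, and e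
   is in the preimage of eta iff unshift a e is in eta. *)

Set Implicit Arguments.
Unset Strict Implicit.
Unset Printing Implicit Defensive.

Import Order.TTheory.
Local Open Scope classical_set_scope.
Local Open Scope order_scope.

(** * Topology of the space of tight filters, and openness of [T1] *)

Lemma cvg_initial (S : choiceType) (T : topologicalType) (f : S -> T)
    (F : set_system S) (s : S) : Filter F ->
  f @ F --> f s -> F --> (s : initial_topology f).
Proof.
move=> FF Ff A; rewrite /= nbhsE => -[_ [[C Co <-] Cs] CA].
by apply: (filterS CA); apply: Ff; exact: open_nbhs_nbhs.
Qed.

Lemma set_val_continuous (T : topologicalType) (A : set T) :
  continuous (set_val : A -> T).
Proof. exact: initial_continuous. Qed.

Section TightFilterTopology.
Context (d : Order.disp_t) (B : cbDistrLatticeType d) (L : eqType).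
Variable D : gbds B L.

(** For [e] in [ES D], evaluation at [e] is continuous into the discrete space [bool], hence locally
    constant; any other [e] lies in no filter. *)
Lemma near_tight_mem (xi : tight_filter D) e :
  \forall eta \near xi, sval eta e <-> sval xi e.
Proof.
have [eE|eE] := pselect (ES D e); last first.
  have nE (eta : tight_filter D) : ~ sval eta e.
    by case: (svalP eta) => -[hE _ _ _ _] _ /hE.
  by apply: (@nearW _ (nbhs xi)) => eta; split=> /nE.
pose i : set_type (ES D) := exist _ e (mem_set eE).
have ci : {for xi, continuous ((@proj _ (fun=> bool) i) \o @char_filter d B L D)}.
  apply: continuous_comp; last exact: proj_continuous.
  exact: (@initial_continuous _ _ (@char_filter d B L D)).
have := ci _ (discrete_set1 _); apply: (@filterS _ (nbhs xi)) => eta /= h.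
move: h; rewrite /proj /char_filter /= => h.
by split=> hm; apply/asboolP; [rewrite -h | rewrite h]; exact/asboolP.
Qed.

Lemma open_tight_mem e : open [set eta : tight_filter D | sval eta e].
Proof.
rewrite openE => eta etae; have := near_tight_mem eta e.
by apply: (@filterS _ (nbhs eta)) => zeta [_]; exact.
Qed.

(** The topology is initial for [char_filter], and pointwise convergence is the supremum of the
    topologies induced by evaluations into discrete [bool]. Peeling off these layers leaves one
    condition per element of [ES D]. *)
Lemma cvg_tight_filter (F : set_system (tight_filter D)) (xi : tight_filter D) :
  Filter F -> (forall e, ES D e -> F [set eta | sval eta e <-> sval xi e]) ->
  F --> xi.
Proof.
move=> FF h; apply: cvg_initial.
apply/(@cvg_sup _ _ _ (@char_filter _ _ _ D @ F) (char_filter xi)) => -[e eE].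
apply: (@cvg_initial _ bool
  (fun g : {ptws set_type (ES D) -> bool} => g (exist _ e eE))
  (@char_filter _ _ _ D @ F) (char_filter xi)).
have FD := h e (set_mem eE).
apply/(@discrete_cvg bool).
apply: (@filterS _ F FF _ _ _ FD) => eta heta; exact: (asbool_equiv_eq heta).
Qed.

Lemma subset_T1 a x : [set eta : tight_filter D | sval eta (idm [:: a] x)] `<=` T1 D.
Proof.
move=> eta hx; have hf := proj1 (svalP eta); have hw := wordP eta.
have W v y : sval eta (idm v y) -> Wstar D v.
  move=> /(filter_idm hf)[y0 hy] vE; apply: y0.
  by move: hy; rewrite vE.
have [] := assoc_word_prefix hf hw hx; move: hw; rewrite /T1 /=.
case: (word eta) => [w|f] /= [].
  by move=> [y /W ww] _ ? _; split.
move=> pre long _ aE; split=> // -[//|n] _.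
(* Some first entry [v] is long enough; [filter_take] passes up to its truncation, which is the
   segment of [f] of length [n.+1]. *)
have [v [y [hy nv]]] := long n.+1.
have vE := pre _ _ hy; case: v nv vE hy => [//|b v] nv vE hy.
have [z hz] : exists z, sval eta (idm (b :: take n v) z).
  by apply: (@filter_take _ _ _ _ _ _ _ (drop n v) y hf); rewrite cat_take_drop.
suff -> : mkseq f n.+1 = b :: take n v by exact: W hz.
have -> : b :: take n v = take n.+1 (b :: v) by [].
by rewrite vE; have /= := @take_gtake _ n.+1 (size v).+1 (Inf f) nv => ->.
Qed.

Lemma T1_letter (xi : tight_filter D) : T1 D xi ->
  exists a x, sval xi (idm [:: a] x).
Proof.
move=> hxi; have hf := proj1 (svalP xi).
have [[a ga] /= waE] := word_T1 (exist _ xi (mem_set hxi)).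
exists a.
have := cut_fam_neq0 hf ((word_eq xi _).2 waE) (_ : gle 0 ga).
by case: ga {waE} => [w|f] /=; [rewrite take0|]; apply.
Qed.

Lemma open_T1 : open (T1 D).
Proof.
rewrite openE => xi /T1_letter[a [x hx]].
apply: (@filterS _ (nbhs xi) _ _ _ (@subset_T1 a x)).
by apply: open_nbhs_nbhs; split=> //; exact: open_tight_mem.
Qed.

End TightFilterTopology.

(** * Deleting a leading letter in [E(S)], and preimages of tight filters *)

Section PrependLetter.
Context (d : Order.disp_t) (B : cbDistrLatticeType d) (L : eqType).
Variable D : gbds B L.

Lemma leS_trans (u : seq L) (x : B) e f : x <> \bot -> ES D e -> ES D f ->
  leS D (idm u x) e -> leS D e f -> leS D (idm u x) f.
Proof.
move=> x0 [->|[v [y [y0 _ ->]]]]; first by [].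
move=> [->|[w [z [z0 _ ->]]]]; first by [].
move=> /(leS_idm _ _ _ _ x0)[m -> xy] /(leS_idm _ _ _ _ y0)[m' -> yz].
apply/leS_idm => //; exists (m' ++ m); first by rewrite catA.
by rewrite actw_cat (le_trans xy) ?actw_le.
Qed.

Lemma leS_refl (u : seq L) (x : B) : x <> \bot -> leS D (idm u x) (idm u x).
Proof. by move=> x0; apply/leS_idm => //; exists [::]; rewrite ?cats0. Qed.

Lemma filter_dir_leS xi e f : Defs.filterE D xi -> xi e -> xi f -> exists w y,
  [/\ y <> \bot, idealw D w y, xi (idm w y),
      leS D (idm w y) e & leS D (idm w y) f].
Proof.
move=> hf he hfi; have [_ _ _ _ hD] := hf.
have [g [hg ge gf]] := hD _ _ he hfi.
by have [w [y [y0 hy gE]]] := filter_elt hf hg; exists w, y; rewrite -gE.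
Qed.

(* Deletes a leading a, pulling elements with empty word along act D a, and
   sends every other element to 0. *)
Definition unshift (a : L) (e : triple B L) : triple B L :=
  match e with
  | Some ([::], x, _) => tri [::] (act D a x) [::]
  | Some (b :: v, x, _) => if b == a then idm v x else None
  | None => None
  end.

Lemma unshift_cons a v x : unshift a (idm (a :: v) x) = idm v x.
Proof. by rewrite /= eqxx. Qed.

Lemma ES_unshift a e : ES D e -> ES D (unshift a e).
Proof.
move=> [->|[[|b v] [x [x0 hx ->]]]] /=; first by left.
  by rewrite /tri; case: eqP => h; [left | apply/ES_idm].
case: eqP => _; last by left.
by apply/ES_idm; split=> //; exact: (@idealw_catr _ _ _ _ [:: b]).
Qed.

(** This acts as an adjunction between prefixing [a] and [unshift a], through which monotonicity,
    covers and filters are transported. *)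
Lemma leS_unshift a e w y : ES D e -> y <> \bot ->
  leS D (idm w y) (unshift a e) <-> leS D (idm (a :: w) y) e.
Proof.
move=> eE y0; case: eE => [->|[[|b v] [x [x0 hx ->]]]] /=; first by [].
  (* If [act D a x] vanishes, [unshift a e] is 0, and nothing nonzero with a word [a :: w] lies
     below [e] either. *)
  rewrite /tri; case: eqP => [ax0|ax0].
    split=> [//|/(leS_idm _ _ _ _ y0)[_ /= <-]] /=.
    by rewrite ax0 actw0 lex0 => /eqP.
  by split=> /(leS_idm _ _ _ _ y0)[_ /= <- h]; apply/leS_idm => //;
    eexists; try reflexivity.
case: eqP => [->|ba]; last first.
  by split=> [//|/(leS_idm _ _ _ _ y0)[m [ab]]]; case: ba.
split=> /(leS_idm _ _ _ _ y0)[m] => [->|[->]] h; apply/leS_idm => //;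
  by exists m.
Qed.

(** Membership in [idealw D w] would not suffice for a lift to the word [a :: w]. The bound by [e]
    supplies the rest: [y] lies below an image under [actw D (a :: w)], or the action carries along
    the ideal of the word of [e]. *)
Lemma idealw_unshift a e w y : ES D e -> y <> \bot ->
  leS D (idm w y) (unshift a e) -> idealw D (a :: w) y.
Proof.
move=> eE y0 /(leS_unshift _ _ eE y0).
case: eE => [->|[[|b v] [x [x0 hx ->]]]]; first by [].
  move=> /(leS_idm _ _ _ _ y0)[_ /= <- h].
  exact: (idealw_down h (@idealw_actw _ _ _ D (a :: w) x)).
move=> /(leS_idm _ _ _ _ y0)[m -> h].
exact: (idealw_down h (idealw_catl m hx)).
Qed.

Lemma unshift_mono a e f : ES D e -> ES D f -> leS D e f ->
  leS D (unshift a e) (unshift a f).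
Proof.
move=> eE fE ef; case: (ES_unshift a eE) => [->|]; first exact: leS0.
move=> [w [y [y0 _ hE]]]; rewrite hE; have := leS_refl w y0.
rewrite -{2}hE => /(leS_unshift _ _ eE y0) h.
by apply/leS_unshift => //; exact: leS_trans ef.
Qed.

Lemma mulS_unshift a e w y : ES D e ->
  mulS D (idm (a :: w) y) e <> None -> mulS D (idm w y) (unshift a e) <> None.
Proof.
move=> [->|[v [c [c0 _ ->]]]]; first by [].
case/mul_idm_neq0 => [[k -> hk]|[k]].
  by rewrite unshift_cons mul_idm_catr tri_id.
case: v => [kE|b v [<- ->] hk]; last first.
  by rewrite unshift_cons mul_idm_catl tri_id.
rewrite -[k]/([::] ++ k) -kE => hk.
(* Here [k] is [a :: w], so the nonzero meet involves [actw D w (act D a c)]. *)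
have ac0 : act D a c <> \bot by move=> h; apply: hk; rewrite /= h actw0 meetx0.
have -> : unshift a (idm [::] c) = idm [::] (act D a c) by rewrite /= tri_id.
by rewrite (@mul_idm_catl _ _ _ D [::] w) tri_id.
Qed.

(* A nonzero (w, y, w) below unshift a e lifts to (a :: w, y, a :: w) below e. *)
Lemma cover_unshift a e Z : ES D e -> is_cover D e Z ->
  is_cover D (unshift a e) (unshift a @` Z).
Proof.
move=> eE [Zfin ZE Zcov]; split; first exact: finite_image.
  move=> _ [z /ZE[zE ze] <-]; split; first exact: ES_unshift.
  exact: unshift_mono.
move=> _ [->//|[w [y [y0 _ ->]]]] _ h.
have [||| z Zz hz] := Zcov (idm (a :: w) y) => //.
- by apply/ES_idm; split=> //; exact: idealw_unshift h.
- exact/leS_unshift.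
exists (unshift a z); first by exists z.
by apply: mulS_unshift => //; have [] := ZE _ Zz.
Qed.

(** [ES D e] is imposed because [unshift] ignores the last word of a triple and can send triples
    outside [ES D] into it. *)
Definition prepend (a : L) (eta : set (triple B L)) : set (triple B L) :=
  [set e | ES D e /\ eta (unshift a e)].

(** The hypotheses on [x] put [idm [:: a] x] in the preimage. The filter axioms follow by lifting
    elements of [eta] below [unshift a e], and tightness from [cover_unshift]. *)
Lemma prepend_tight a x eta : ideal D a x -> is_tight D eta ->
  eta (idm [::] x) -> is_tight D (prepend a eta).
Proof.
move=> ax [hf ht] etax; have [_ _ eta0 etaU _] := hf.
have leE w y e : eta (idm w y) -> ES D e -> leS D (idm (a :: w) y) e ->
    prepend a eta e.
  move=> hwy eE le_e; have [y0 _] := filter_idm hf hwy; split=> //.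
  apply: etaU hwy _ _; first exact: ES_unshift.
  exact/leS_unshift.
have lift e : prepend a eta e -> exists w y,
    [/\ y <> \bot, eta (idm w y), prepend a eta (idm (a :: w) y) &
        leS D (idm (a :: w) y) e].
  move=> [eE he].
  have [w [y [y0 _ hwy le_e le_x]]] := filter_dir_leS hf he etax.
  exists w, y; have yi := idealw_unshift eE y0 le_e; split=> //.
    by split; [apply/ES_idm | rewrite unshift_cons].
  exact/leS_unshift.
split; first split.
- by move=> e [].
- have [x0 _] := filter_idm hf etax.
  exists (idm [:: a] x); split; last by rewrite unshift_cons.
  by apply/ES_idm; split=> //; exists x.
- by case.
- move=> e f he fE ef; have [eE _] := he.
  have [w [y [y0 hwy _ le_e]]] := lift _ he.
  exact: (leE _ _ _ hwy fE (leS_trans y0 eE fE le_e ef)).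
- move=> e f [eE he] [fE hfi].
  have [w [y [y0 _ hwy le_e le_f]]] := filter_dir_leS hf he hfi.
  exists (idm (a :: w) y); split; [|exact/leS_unshift..].
  split; last by rewrite unshift_cons.
  by apply/ES_idm; split=> //; exact: idealw_unshift le_e.
move=> e Z [eE he] Zcov; have [_ ZE _] := Zcov.
have [_ [z Zz <-] hz] := ht _ _ he (cover_unshift a eE Zcov).
by exists z => //; split=> //; have [] := ZE _ Zz.
Qed.

End PrependLetter.

(** * The shift on filters containing a fixed [idm [:: a] x] *)

Section ShiftInverse.
Context (d : Order.disp_t) (B : cbDistrLatticeType d) (L : eqType).
Variable D : gbds B L.

Lemma sval_tight_filter_inj (xi eta : tight_filter D) :
  sval xi = sval eta -> xi = eta.
Proof. by case: xi eta => [xi hxi] [eta heta] /= h; exact: eq_exist. Qed.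

(** The hypothesis identifies [a] as the first letter of the word, which removes the chosen
    decomposition from [sigma]. *)
Lemma sigmaP (xi : T1 D) a x v y : sval (set_val xi) (idm [:: a] x) ->
  sval (sigma D xi) (idm v y) <->
  idealw D v y /\ exists2 z, sval (set_val xi) (idm (a :: v) z) & z <= y.
Proof.
move=> hx; have hf := proj1 (svalP (set_val xi)).
have [[b ga] hE'] := word_T1 xi; have hE : word _ = gcons b ga := hE'.
have hw := (word_eq _ _).2 hE.
have [-> _ _] := assoc_word_cons hf hw hx.
by rewrite (sigmaE hE); exact: (cutP hf hw).
Qed.

(** A common lower bound with [idm [:: a] x] turns the existential of [sigmaP] into membership of
    one element independent of [xi], the form that continuity requires. *)
Lemma sigma_meetP (xi : T1 D) a x v y : sval (set_val xi) (idm [:: a] x) ->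
  sval (sigma D xi) (idm v y) <->
  idealw D v y /\ sval (set_val xi) (idm (a :: v) (y `&` actw D v x)).
Proof.
move=> hx; have hf := proj1 (svalP (set_val xi)).
have [_ xi1] := filter_idm hf hx.
split=> [/(sigmaP _ _ hx)[hv [z hz zy]]|[hv h]]; last first.
  by apply/(sigmaP _ _ hx); split=> //; eexists; [exact: h | rewrite leIl].
split=> //; have [m [m' [t [ht [mE] tz tx]]]] := filter_dir hf hz hx.
apply: (@filter_up _ _ _ D _ (a :: v) m t _ hf ht).
  apply: idealw_down (@idealw_catl _ _ _ D [:: a] v x xi1).
  by rewrite leIr.
rewrite actwI lexI -actw_cat mE tx andbT.
exact/(le_trans tz)/actw_le.
Qed.

(** Used to see that [prepend D a] undoes [sigma]. *)
Lemma sigma_unshift (xi : T1 D) a x e : sval (set_val xi) (idm [:: a] x) ->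
  ES D e -> sval (sigma D xi) (unshift D a e) <-> sval (set_val xi) e.
Proof.
move=> hx eE; have hf := proj1 (svalP (set_val xi)).
have [_ _ s0 _ _] := proj1 (svalP (sigma D xi)).
case: eE => [->|[[|b v] [z [z0 hz ->]]]].
- by split=> // h; have [_ _ + _ _] := hf; case.
(* A common lower bound with [idm [:: a] x] has a word starting with [a], so it already lies below
   [idm [:: a] (act D a z)]. *)
- have dir : sval (set_val xi) (idm [::] z) ->
      sval (set_val xi) (idm [:: a] (act D a z)).
    move=> h; have [m [m' [t [ht /= mE tz _]]]] := filter_dir hf h hx.
    apply: (@filter_up _ _ _ D _ [:: a] m' t _ hf) => /=.
    + by rewrite -mE.
    + exact: (@idealw_actw _ _ _ D [:: a]).
    + by move: tz; rewrite mE.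
  rewrite -[unshift _ _ _]/(tri [::] (act D a z) [::]) /tri.
  case: eqP => [az0|_].
    split=> [//|/dir]; rewrite az0.
    by move=> /(filter_idm hf)[].
  split=> [/(sigmaP _ _ hx)[_ [t ht tz]]|/dir h].
    exact: (@filter_up _ _ _ D _ [::] [:: a] t _ hf ht).
  by apply/(sigmaP _ _ hx); split=> //; exists (act D a z).
rewrite -[unshift _ _ _]/(if b == a then idm v z else None).
case: eqP => [ba|ba]; last first.
  split=> [//|h]; case: ba.
  by have [m [m' [t [_ [ab]]]]] := filter_dir hf h hx.
rewrite {}ba in hz *; split=> [/(sigmaP _ _ hx)[_ [t ht tz]]|h].
  by apply: (@filter_up _ _ _ D _ (a :: v) [::] t _ hf); rewrite ?cats0.
apply/(sigmaP _ _ hx); split; last by exists z.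
exact: (@idealw_catr _ _ _ _ [:: a]).
Qed.

Lemma sigma_prepend (xi : T1 D) (eta : tight_filter D) a x :
  ideal D a x -> sval eta (idm [::] x) ->
  sval (set_val xi) = prepend D a (sval eta) -> sigma D xi = eta.
Proof.
move=> ax etax xiE; have hf := proj1 (svalP eta).
have [x0 _] := filter_idm hf etax.
have hx : sval (set_val xi) (idm [:: a] x).
  by rewrite xiE; split; [apply/ES_idm; split=> //; exists x | rewrite unshift_cons].
have [sE _ _ _ _] := proj1 (svalP (sigma D xi)).
have [tE _ _ _ _] := hf.
apply: sval_tight_filter_inj; apply/seteqP; split=> e he.
  have [eN|[v [y [y0 hy eE]]]] := sE _ he.
    by have [_ _ + _ _] := proj1 (svalP (sigma D xi)); case; rewrite -eN.
  move: he; rewrite {}eE => /(sigmaP _ _ hx)[_ [z]].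
  rewrite xiE => -[_]; rewrite unshift_cons => hz zy.
  by apply: (@filter_up _ _ _ D _ v [::] z _ hf); rewrite ?cats0.
have [v [y [y0 hy eE]]] := filter_elt hf he.
move: he; rewrite {}eE => he; apply/(sigmaP _ _ hx); split=> //.
have [w [z [z0 hz hwz]]] := filter_dir_leS hf he etax.
move=> /(leS_idm _ _ _ _ z0)[m wE zy] /(leS_idm _ _ _ _ z0)[m' /= m'E zx].
(* [y] itself is only known to lie in [idealw D v]; meeting it with [actw D v x] makes the element
   liftable to the word [a :: v]. *)
have yi : idealw D (a :: v) (y `&` actw D v x).
  by exists x => //; rewrite leIr.
have h : sval eta (idm v (y `&` actw D v x)).
  apply: (@filter_up _ _ _ D _ v m z _ hf); rewrite -?wE //.
    exact: (@idealw_catr _ _ _ _ [:: a]).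
  by rewrite actwI lexI zy -actw_cat -wE m'E.
exists (y `&` actw D v x); last by rewrite leIl.
rewrite xiE; split; last by rewrite unshift_cons.
by apply/ES_idm; split=> //; have [] := filter_idm hf h.
Qed.

End ShiftInverse.

(** * Assembling the local inverses of [sigma] *)

Theorem proposition5p11 (d : Order.disp_t) (B : cbDistrLatticeType d)
    (L : eqType) (D : gbds B L) :
  open (T1 D) /\ local_homeomorphism (sigma D).
Proof.
split; first exact: open_T1.
move=> xi; have [a [x hx]] := T1_letter (set_valP xi).
have ax : ideal D a x.
  have [_ [y ay xy]] := filter_idm (proj1 (svalP (set_val xi))) hx.
  exact: ideal_down xy ay.
pose U := [set u : T1 D | sval (set_val u) (idm [:: a] x)].
pose V := [set eta : tight_filter D | sval eta (idm [::] x)].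
have in_prepend (eta : tight_filter D) :
    V eta -> prepend D a (sval eta) (idm [:: a] x).
  move=> Veta; have [x0 _] := filter_idm (proj1 (svalP eta)) Veta.
  split; last by rewrite unshift_cons.
  by apply/ES_idm; split=> //; exists x.
(* The inverse must be a total function; outside [V] it takes the default value [xi]. *)
have /choice[g gE] : forall eta : tight_filter D, exists u : T1 D,
    V eta -> sval (set_val u) = prepend D a (sval eta).
  move=> eta; have [Veta|nV] := pselect (V eta); last by exists xi.
  pose zeta : tight_filter D := exist _ _ (prepend_tight ax (svalP eta) Veta).
  have zetaT : T1 D zeta by apply: (@subset_T1 _ _ _ D a x); exact: in_prepend.
  by exists (exist _ zeta (mem_set zetaT)).
have gU eta : V eta -> U (g eta).
  by move=> Veta; rewrite /U /= gE //; exact: in_prepend.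
have sg eta : V eta -> sigma D (g eta) = eta.
  by move=> Veta; apply: (sigma_prepend ax Veta); exact: gE.
have UV u : U u -> V (sigma D u).
  by move=> Uu; apply/(sigmaP _ _ Uu); split=> //; exists x.
have imU : sigma D @` U = V.
  apply/seteqP; split=> [_ [u Uu <-]|eta Veta]; first exact: UV.
  by exists (g eta); [exact: gU | exact: sg].
have near_T1 (u : T1 D) e :
    \forall v \near u, sval (set_val v) e <-> sval (set_val u) e.
  exact: (@set_val_continuous _ (T1 D) u _ (near_tight_mem (set_val u) e)).
exists U; split=> //.
- apply: (@open_comp _ _ (set_val : T1 D -> _)
    [set eta | sval eta (idm [:: a] x)]); last exact: open_tight_mem.
  by move=> u _; exact: set_val_continuous.
- by rewrite imU; exact: open_tight_mem.
- apply/subspace_continuousP => u Uu; apply: cvg_tight_filter => e.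
  case=> [->|[v [y [_ _ ->]]]].
    apply: filterE => w; have [_ _ n1 _ _] := proj1 (svalP w).
    by have [_ _ n2 _ _] := proj1 (svalP (sigma D u)); split=> [/n1|/n2].
  (* As [x] is fixed on [U], this element decides membership in [sigma] at [u] and at all nearby [w]
     in [U] alike. *)
  have := near_T1 u (idm (a :: v) (y `&` actw D v x)).
  apply: (@filterS _ (nbhs u)) => w h Uw.
  by split=> [/(sigma_meetP _ _ Uw)|/(sigma_meetP _ _ Uu)] [vy /h hz];
    [apply/(sigma_meetP _ _ Uu) | apply/(sigma_meetP _ _ Uw)].
exists g; split=> [u Uu|].
  apply: val_inj; apply: sval_tight_filter_inj; rewrite (gE _ (UV _ Uu)).
  have [uE _ _ _ _] := proj1 (svalP (set_val u)).
  apply/seteqP; split=> e; first by case=> eE /(sigma_unshift Uu eE).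
  by move=> he; have eE := uE _ he; split=> //; apply/(sigma_unshift Uu eE).
rewrite imU; apply/subspace_continuousP => eta Veta.
(* [cvg_initial] removes the subspace topology of [T1 D], leaving convergence of tight filters. *)
apply: cvg_initial; apply: cvg_tight_filter => e eE.
have := near_tight_mem eta (unshift D a e).
apply: (@filterS _ (nbhs eta)) => zeta h Vzeta.
suff : sval (set_val (g zeta)) e <-> sval (set_val (g eta)) e by [].
rewrite !gE //.
by split=> -[_ /h].
Qed.
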